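(* Let $n\ge 1$. The cohomology algebra of the DG algebra $\mathcal{A}(1,0,\cdots,0)$ (with underlying graded algebra $\Bbbk[x_1,\cdots,x_n]$) is the polynomial algebra $$\Bbbk[\lceil x_2^2\rceil,\lceil x_2x_3\rceil,\cdots,\lceil x_2x_n\rceil,\lceil x_3^2\rceil,\cdots,\lceil x_3x_n\rceil,\cdots,\lceil x_{n-1}^2\rceil,\lceil x_{n-1}x_n\rceil,\lceil x_n^2\rceil],$$ that is, the polynomial algebra on the classes $\lceil x_ix_j\rceil$ with $2\le i\le j\le n$.
   Context: $\Bbbk$ is an algebraically closed field of characteristic $0$. A cochain DG algebra is a graded $\Bbbk$-algebra $\mathcal{A}$ with a $\Bbbk$-linear differential $\partial_{\mathcal{A}}$ of degree $1$, $\partial_{\mathcal{A}}^2=0$, satisfying $\partial_{\mathcal{A}}(ab)=(\partial_{\mathcal{A}}a)b+(-1)^{|a|}a(\partial_{\mathcal{A}}b)$ for all homogeneous $a,b$. For $(t_1,\dots,t_n)\in\Bbbk^n$, $\mathcal{A}(t_1,\dots,t_n)$ denotes the cochain DG algebra whose underlying graded algebra is the ordinary commutative polynomial algebra $\Bbbk[x_1,\dots,x_n]$ with $|x_i|=1$ and whose differential is determined, via the Leibniz rule, by $\partial_{\mathcal{A}}(x_i)=\sum_{j=1}^{n}t_jx_ix_j$ for all $i$; so in $\mathcal{A}(1,0,\dots,0)$ one has $\partial_{\mathcal{A}}(x_i)=x_1x_i$. For a cocycle $z$, $\lceil z\rceil$ denotes its class in the cohomology graded algebra $H(\mathcal{A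})$.
   Formalization: For n≥3 the classes are not algebraically independent (⌈x_2²⌉⌈x_3²⌉=⌈x_2x_3⌉²), so ''polynomial algebra on the classes'' is replaced by: the classes generate H(A), and their relations are exactly those of the monomials x_ix_j (2≤i≤j≤n) in the polynomial ring. *)

(* Defs.v *)
From HB Require Import structures.
From mathcomp Require Import all_boot all_algebra.
From mathcomp Require Import ring.
From mathcomp Require Import boolp.
From mathcomp Require Import mpoly.

Set Implicit Arguments.
Unset Strict Implicit.
Unset Printing Implicit Defensive.

Import GRing.Theory.
Local Open Scope ring_scope.
Local Open Scope quotient_scope.

(* A cochain DG algebra whose underlying graded algebra is K[x_1, ..., x_n] with
   |x_i| = 1, so that degree e is [e.-homog].  The variable x_i is ['X_j] with
   j : 'I_n of value i - 1. *)
Record dg_mpoly (K : fieldType) (n : nat) := DGMpoly {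
  dg_diff :> {linear {mpoly K[n]} -> {mpoly K[n]}};
  dg_diff_homog : forall e p, p \is e.-homog -> dg_diff p \is e.+1.-homog;
  dg_diffK : forall p, dg_diff (dg_diff p) = 0;
  dg_diffM : forall e p q, p \is e.-homog ->
    dg_diff (p * q) = dg_diff p * q + (-1) ^+ e * (p * dg_diff q)
}.

Section Cohomology.
Variables (K : fieldType) (n : nat) (A : dg_mpoly K n).
Implicit Types p q : {mpoly K[n]}.

Lemma dg_pihomog e p : A (pihomog mdeg e p) = pihomog mdeg e.+1 (A p).
Proof.
pose k := maxn (mmeasure mdeg p) e.+1.
have hA i : A (pihomog mdeg i p) \is i.+1.-homog.
  exact/dg_diff_homog/pihomogP.
have dp : A p = \sum_(i < k) A (pihomog mdeg i p).
  rewrite [in LHS](@pihomog_partitionE _ _ mdeg k p) ?leq_maxl //.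
  exact: (raddf_sum (dg_diff A)).
rewrite [in RHS]dp [RHS](raddf_sum (@pihomog n K mdeg e.+1)) /=.
rewrite [RHS](bigD1 (Ordinal (leq_maxr _ _ : (e < k)%N))) //=.
rewrite [X in _ = _ + X]big1 ?addr0 => [|i ne_ie]; first by rewrite (pihomog_dE (hA e)).
apply: (@pihomog_ne0 _ _ _ i.+1) => //.
Qed.

Lemma pihomog_sum p : exists k, p = \sum_(e < k) pihomog mdeg e p.
Proof. by exists (mmeasure mdeg p); apply: pihomog_partitionE. Qed.

Definition cocycle : {pred {mpoly K[n]}} := fun p => A p == 0.

Lemma cocycle_pihomog e p : p \in cocycle -> A (pihomog mdeg e p) = 0.
Proof. by move=> /eqP dp; rewrite dg_pihomog dp raddf0. Qed.

Lemma dg_diff1 : A 1 = 0.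
Proof.
have := dg_diffM A 1 (dhomog1 K mdeg : 1 \is 0.-homog).
rewrite !(mulr1, mul1r, expr0) => /esym/eqP.
by rewrite -subr_eq0 addrK => /eqP.
Qed.

Lemma cocycleM : {in cocycle &, forall p q, p * q \in cocycle}.
Proof.
move=> p q Zp /eqP dq; have [k pE] := pihomog_sum p.
rewrite unfold_in {1}pE mulr_suml (raddf_sum (dg_diff A)) big1 //= => i _.
by rewrite (dg_diffM _ _ (pihomogP _ _ _)) cocycle_pihomog // dq mulr0 mul0r mulr0 addr0.
Qed.

Lemma cocycle_subalg : subalg_closed cocycle.
Proof.
split; first by rewrite unfold_in dg_diff1.
- move=> a p q /eqP dp /eqP dq.
  by rewrite unfold_in linearP dp dq scaler0 addr0.
- exact: cocycleM.
Qed.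

HB.instance Definition _ :=
  GRing.isSubalgClosed.Build K {mpoly K[n]} cocycle cocycle_subalg.

Record cocycles := Cocycle { cocycle_val : {mpoly K[n]}; _ : cocycle_val \in cocycle }.
HB.instance Definition _ := [isSub for cocycle_val].
HB.instance Definition _ := [Choice of cocycles by <:].
HB.instance Definition _ := [SubChoice_isSubComNzRing of cocycles by <:].
HB.instance Definition _ := [SubNmodule_isSubLSemiModule of cocycles by <:].
HB.instance Definition _ := [SubNzRing_SubLmodule_isSubLalgebra of cocycles by <:].
HB.instance Definition _ := [SubLalgebra_isSubAlgebra of cocycles by <:].

(* The cohomology ker d / im d is not split into its graded pieces: as d is
   homogeneous, it is the direct sum over e of the spaces of classes of cocycles
   that are homogeneous of degree e. *)
Definition coboundary : {pred cocycles} := fun z => `[< exists p, A p = val z >].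

Lemma coboundaryP z : reflect (exists p, A p = val z) (z \in coboundary).
Proof. exact: asboolP. Qed.

Lemma coboundary_idealr : idealr_closed coboundary.
Proof.
split.
- by apply/coboundaryP; exists 0; rewrite raddf0 raddf0.
- apply/negP => /coboundaryP[p /(congr1 (pihomog mdeg 0))].
  rewrite rmorph1 (pihomog_dE (dhomog1 _ _)) => d1.
  have [k dp] := pihomog_sum p.
  have: (1 : {mpoly K[n]}) == 0; last by rewrite oner_eq0.
  rewrite -d1 dp (raddf_sum (dg_diff A)) (raddf_sum (@pihomog n K mdeg 0)) big1 //= => i _.
  by apply: (@pihomog_ne0 _ _ _ i.+1) => //; exact/dg_diff_homog/pihomogP.
- move=> a u v /coboundaryP[p dp] /coboundaryP[q dq]; apply/coboundaryP.
  have [k da] := pihomog_sum (val a).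
  exists (\sum_(e < k) (-1) ^+ e * (pihomog mdeg e (val a) * p) + q).
  have -> : val (a * u + v) = val a * val u + val v by [].
  rewrite (raddfD (dg_diff A)) /= dq -dp {2}da mulr_suml (raddf_sum (dg_diff A)); congr (_ + _).
  apply: eq_bigr => i _; have Zi := cocycle_pihomog i (valP a).
  have sgn e r : A ((-1) ^+ e * r) = (-1) ^+ e * A r.
    by rewrite -signr_odd !mulr_sign; case: odd => //; rewrite raddfN.
  rewrite /= sgn (dg_diffM _ _ (pihomogP _ _ _)) Zi mul0r add0r mulrA.
  by rewrite -exprMn mulrNN mulr1 expr1n mul1r.
Qed.

HB.instance Definition _ := isIdealr.Build cocycles coboundary coboundary_idealr.

Definition cohomology := {ideal_quot coboundary}.
HB.instance Definition _ := GRing.ComNzRing.on cohomology.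

Definition cohom_scale (c : K) (h : cohomology) : cohomology :=
  \pi_cohomology (c%:A : cocycles) * h.

Lemma cohom_scaleA a b h : cohom_scale a (cohom_scale b h) = cohom_scale (a * b) h.
Proof. by rewrite /cohom_scale mulrA -rmorphM /= -scalerAl mul1r scalerA. Qed.

Lemma cohom_scale1 : left_id 1 cohom_scale.
Proof. by move=> h; rewrite /cohom_scale scale1r rmorph1 mul1r. Qed.

Lemma cohom_scaleDr : right_distributive cohom_scale +%R.
Proof. by move=> c h h'; rewrite /cohom_scale mulrDr. Qed.

Lemma cohom_scaleDl h : {morph cohom_scale^~ h : a b / a + b}.
Proof. by move=> a b; rewrite /cohom_scale scalerDl rmorphD mulrDl. Qed.

HB.instance Definition _ := GRing.Zmodule_isLmodule.Build K cohomology
  cohom_scaleA cohom_scale1 cohom_scaleDr cohom_scaleDl.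

Lemma cohom_scaleAl (c : K) (h h' : cohomology) : c *: (h * h') = c *: h * h'.
Proof. exact: mulrA. Qed.

HB.instance Definition _ :=
  GRing.Lmodule_isLalgebra.Build K cohomology cohom_scaleAl.
HB.instance Definition _ := GRing.Lalgebra_isComAlgebra.Build K cohomology.

Lemma pi_cohomologyZ (c : K) (z : cocycles) :
  \pi_cohomology (c *: z) = c *: (\pi_cohomology z : cohomology).
Proof. by rewrite -[z in LHS]mul1r scalerAl rmorphM. Qed.

(* The class of p when p is a cocycle; the junk value 0 otherwise. *)
Definition cohom_class p : cohomology := \pi_cohomology (insubd (0 : cocycles) p).

Lemma cohom_classM : {in cocycle &, {morph cohom_class : p q / p * q}}.
Proof.
move=> p q Zp Zq; rewrite /cohom_class -rmorphM; congr \pi.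
by apply: val_inj; rewrite rmorphM /= !insubdK // cocycleM.
Qed.

End Cohomology.

(* [A] is A(t_1, ..., t_n), with t_(j + 1) written [t j]. *)
Definition is_dg_A (K : fieldType) (n : nat) (t : 'I_n -> K) (A : dg_mpoly K n) :=
  forall i : 'I_n, A 'X_i = \sum_(j < n) t j *: ('X_i * 'X_j).

Section Existence.
Variables (K : fieldType) (n : nat) (t : 'I_n -> K).
Hypothesis charK : [pchar K] =i pred0.
Implicit Types p q : {mpoly K[n]}.

Let sgn : 'I_n -> {mpoly K[n]} := fun i => - 'X_i.
Let sigma : {mpoly K[n]} -> {mpoly K[n]} := mmap (@mpolyC n K) sgn.
Let omega : {mpoly K[n]} := \sum_(j < n) t j *: 'X_j.
Let diff p := omega * (2%:R^-1 *: (p - sigma p)).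

Let diff_linear : linear diff.
Proof.
move=> a p q; rewrite /diff /sigma mmapD mmapZ -!mul_mpolyC.
by ring.
Qed.

HB.instance Definition _ :=
  GRing.isLinear.Build K {mpoly K[n]} {mpoly K[n]} _ diff diff_linear.

Let sigma_homog e p : p \is e.-homog -> sigma p = (-1) ^+ e * p.
Proof.
move=> /dhomogP hp; rewrite [in RHS](mpolyE p) mulr_sumr /sigma /mmap.
apply: eq_big_seq => m /hp dm; rewrite -mul_mpolyC mulrCA; congr (_ * _).
have -> : sgn = (fun i => (-1) * 'X_i) by apply/funext => i; rewrite mulN1r.
rewrite /mmap1 (eq_bigr (fun i => (-1) ^+ m i * 'X_i ^+ m i)); last first.
  by move=> i _; rewrite exprMn_comm //; apply: mulrC.
by rewrite big_split /= prodrXr -mdegE [in RHS]mpolyXE_id dm.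
Qed.

Let omega_homog : omega \is 1.-homog.
Proof. by apply: rpred_sum => j _; apply: rpredZ; rewrite dhomogX /= mdeg1. Qed.

Let diff_homog e p : p \is e.-homog -> diff p \is e.+1.-homog.
Proof.
move=> hp; rewrite -add1n; apply: dhomogM => //; apply: rpredZ.
by rewrite (sigma_homog hp) rpredB // -signr_odd mulr_sign; case: odd; rewrite ?rpredN.
Qed.

Let sigmaM p q : sigma (p * q) = sigma p * sigma q.
Proof. exact: rmorphM. Qed.

Let diffK p : diff (diff p) = 0.
Proof.
have sK q : sigma (sigma q) = q.
  have sS k (F : 'I_k -> {mpoly K[n]}) :
      sigma (\sum_(i < k) F i) = \sum_(i < k) sigma (F i).
    exact: (raddf_sum (mmap (@mpolyC n K) sgn)).
  have [k ->] := pihomog_sum q; rewrite !sS; apply: eq_bigr => i _.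
  have hi := pihomogP mdeg i q; rewrite (sigma_homog hi) (@sigma_homog i).
    by rewrite mulrA -exprMn mulrNN mulr1 expr1n mul1r.
  by rewrite -signr_odd mulr_sign; case: odd; rewrite ?rpredN.
rewrite /diff sigmaM (sigma_homog omega_homog) expr1 /sigma mmapZ mmapB -/sigma.
rewrite -/(sigma p) -/(sigma (sigma p)) sK -!mul_mpolyC.
by ring.
Qed.

Let diffM e p q : p \is e.-homog ->
  diff (p * q) = diff p * q + (-1) ^+ e * (p * diff q).
Proof.
move=> hp; rewrite /diff sigmaM (sigma_homog hp) -!mul_mpolyC.
by ring.
Qed.

Lemma dg_A_exists : exists A, is_dg_A t A.
Proof.
pose A := @DGMpoly K n diff diff_homog diffK diffM.
exists A => i; rewrite /= /diff (@sigma_homog 1) ?dhomogX /= ?mdeg1 //.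
have nz2 : 2%:R != 0 :> K by have := charK 2; rewrite !inE /= => ->.
rewrite expr1 mulN1r opprK -mulr2n -scaler_nat scalerA mulVf // scale1r.
by rewrite mulr_suml; apply: eq_bigr => j _; rewrite -scalerAl mulrC.
Qed.

End Existence.

(* The value at (a_i)_i of a polynomial in variables indexed by I; its image is
   the subalgebra K[a_i, i in I] of S. *)
Definition poly_eval (K : fieldType) (I : finType) (S : comAlgType K) (a : I -> S) :
    {mpoly K[#|I|]} -> S :=
  mmap (GRing.in_alg S) (a \o enum_val).

(* The pairs 2 <= i <= j <= n, shifted to start from 0. *)
Definition quad_index (n : nat) := {ij : 'I_n * 'I_n | (0 < ij.1 <= ij.2)%N}.

Definition quad_mono (K : fieldType) (n : nat) (u : quad_index n) : {mpoly K[n]} :=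
  'X_(val u).1 * 'X_(val u).2.
Arguments quad_mono K {n} u.

Definition quad_class (K : fieldType) (n : nat) (A : dg_mpoly K n)
    (u : quad_index n) : cohomology A :=
  cohom_class A (quad_mono K u).

(* For n >= 3 the classes of the x_i x_j satisfy relations such as
   (x_2 x_3)^2 = x_2^2 x_3^2, so they are never algebraically independent: the
   algebra of polynomials in these classes is not a polynomial ring on them, and
   the model to compare it with is the subalgebra K[x_i x_j] of K[x_2, ..., x_n]. *)
Lemma poly_eval_quad_class_not_inj (K : fieldType) (n : nat) (A : dg_mpoly K n) :
  (2 < n)%N -> (forall u : quad_index n, quad_mono K u \in cocycle A) ->
  ~ injective (poly_eval (quad_class A)).
Proof.
move=> n_gt2 Z inj.
pose i1 := Ordinal (ltnW n_gt2); pose i2 := Ordinal n_gt2.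
pose u : quad_index n := exist _ (i1, i1) isT.
pose v : quad_index n := exist _ (i1, i2) isT.
pose w : quad_index n := exist _ (i2, i2) isT.
pose Y (x : quad_index n) : {mpoly K[#|{: quad_index n}|]} := 'X_(enum_rank x).
have YE x : poly_eval (quad_class A) (Y x) = quad_class A x.
  by rewrite /poly_eval mmapX mmap1U /= enum_rankK.
have YM x y : poly_eval (quad_class A) (Y x * Y y) = quad_class A x * quad_class A y.
  by rewrite -!YE; apply: rmorphM.
have eqY : Y u * Y w = Y v * Y v.
  apply: inj; rewrite !YM /quad_class -!cohom_classM ?Z //; congr cohom_class.
  by rewrite /quad_mono /=; ring.
have := congr1 (meval (fun k => (k != enum_rank v)%:R)) eqY.
rewrite !rmorphM /= !mevalXU !(inj_eq enum_rank_inj) eqxx mul0r mulr1 => /eqP.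
by rewrite oner_eq0.
Qed.

(* Main.v *)
(** On a homogeneous polynomial [p] of odd degree the differential is [x_1 * p],
    and it vanishes in even degrees.  Hence the cocycles are the sums of monomials
    of even degree and the coboundaries are the multiples [x_1 * q] with [q] odd:
    modulo coboundaries only the even monomials in [x_2, ..., x_n] survive, and
    these are products of the [x_i x_j].  No nonzero polynomial in the [x_i x_j],
    [i, j >= 2], is a coboundary, since setting [x_1 = 0] fixes the former and
    kills the latter. *)
Require Import Defs.
From mathcomp Require Import all_boot all_algebra.
From mathcomp Require Import mpoly.

Import GRing.Theory.
Local Open Scope ring_scope.
Local Open Scope quotient_scope.

(** Serves for three maps: setting [x_1 = 0], the inclusion of the cocycles and the projection onto
    cohomology. As [g] is only a ring morphism, its compatibility with scalars is a hypothesis. *)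
Lemma rmorph_poly_eval (K : fieldType) (I : finType) (S T : comAlgType K)
    (g : {rmorphism S -> T}) (a : I -> S) (b : I -> T) P :
    (forall c : K, g c%:A = c%:A) -> (forall i, g (a i) = b i) ->
  g (poly_eval a P) = poly_eval b P.
Proof.
move=> gA gab; rewrite /poly_eval /mmap rmorph_sum; apply: eq_bigr => m _.
rewrite rmorphM /= gA /mmap1 rmorph_prod; congr (_ * _).
by apply: eq_bigr => i _; rewrite rmorphXn /= gab.
Qed.

Lemma mnm_split1 (n : nat) (m : 'X_{1..n}) : mdeg m != 0%N ->
  exists2 i, m i != 0%N & m = (U_(i) + (m - U_(i)))%MM.
Proof.
move=> m_neq0; have /existsP[i mi] : [exists i, m i != 0%N].
  apply: contraR m_neq0 => /existsPn m0; rewrite mdegE big1 // => i _.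
  exact/eqP/negPn.
by exists i => //; rewrite addmC submK // lep1mP.
Qed.

Section FirstVariableDifferential.
Variables (K : fieldType) (n : nat) (A : dg_mpoly K n.+1).
Hypothesis AX : is_dg_A (fun j : 'I_n.+1 => ((j : nat) == 0%N)%:R) A.
Implicit Types (p q : {mpoly K[n.+1]}) (m : 'X_{1..n.+1}) (u : quad_index n.+1).

Local Notation x1 := ('X_ord0 : {mpoly K[n.+1]}).

Lemma diffX i : A 'X_i = x1 * 'X_i.
Proof.
rewrite AX big_ord_recl /= scale1r big1 ?addr0 1?mulrC // => j _.
by rewrite scale0r.
Qed.

(** Induction on the degree: [d(x_i m') = x_1 x_i m' - x_i d(m')], and the two terms cancel exactly
    when [m'] has odd degree. *)
Lemma diff_mpolyX m : A 'X_[m] = if odd (mdeg m) then x1 * 'X_[m] else 0.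
Proof.
have [d] := ubnP (mdeg m); elim: d m => // d IHd m.
have [->|] := eqVneq m 0%MM; first by rewrite mpolyX0 dg_diff1 mdeg0.
rewrite -mdeg_eq0 => /mnm_split1[i _ mE] lt_md.
have dm : mdeg m = (mdeg (m - U_(i))).+1 by rewrite {1}mE mdegD mdeg1.
have hX : ('X_i : {mpoly K[n.+1]}) \is 1.-homog by rewrite dhomogX /= mdeg1.
rewrite {1}mE mpolyXD (dg_diffM _ _ hX) diffX IHd; last by move: lt_md; rewrite dm.
rewrite [in RHS]mE mpolyXD -mE dm /= expr1 mulN1r -mulrA.
by case: ifP => _ /=; [rewrite [in X in _ - X]mulrCA subrr | rewrite mulr0 subr0].
Qed.

Definition odd_part p := \sum_(m <- msupp p | odd (mdeg m)) p@_m *: 'X_[m].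

Lemma diffE p : A p = x1 * odd_part p.
Proof.
rewrite {1}(mpolyE p) (raddf_sum (dg_diff A)) /odd_part mulr_sumr [RHS]big_mkcond.
apply: eq_bigr => m _; rewrite /= linearZ /= diff_mpolyX.
by case: ifP => _; rewrite ?scaler0 // scalerAr.
Qed.

(** Polynomials form a domain, so [x_1 * odd_part p = 0] forces the odd part to vanish. *)
Lemma cocycle_even p : p \in cocycle A ->
  p = \sum_(m <- msupp p | ~~ odd (mdeg m)) p@_m *: 'X_[m].
Proof.
have /negPf x1_neq0 : x1 != 0 by rewrite -msupp_eq0 msuppX.
rewrite unfold_in diffE mulf_eq0 x1_neq0 /= => /eqP odd0.
by rewrite {1}(mpolyE p) (bigID (fun m => odd (mdeg m))) /= -/(odd_part p) odd0 add0r.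
Qed.

Lemma quad_mono_cocycle u : quad_mono K u \in cocycle A.
Proof.
by rewrite unfold_in /quad_mono -mpolyXD diff_mpolyX mdegD !mdeg1.
Qed.

Lemma quad_monoP (i j : 'I_n.+1) : i != ord0 -> j != ord0 ->
  exists u, quad_mono K u = 'X_i * 'X_j.
Proof.
rewrite -!lt0n => i_gt0 j_gt0; have [le_ij|/ltnW le_ji] := leqP i j.
  have H : (0 < (i, j).1 <= (i, j).2)%N by rewrite /= i_gt0.
  by exists (exist _ (i, j) H).
have H : (0 < (j, i).1 <= (j, i).2)%N by rewrite /= j_gt0.
by exists (exist _ (j, i) H); rewrite /quad_mono mulrC.
Qed.

(** Variables are peeled off two at a time, which preserves the parity of the degree and the absence
    of [x_1]. *)
Lemma even_mpolyX_eval m : m ord0 = 0%N -> ~~ odd (mdeg m) ->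
  exists P, 'X_[m] = poly_eval (@quad_mono K n.+1) P.
Proof.
have [d] := ubnP (mdeg m); elim: d m => // d IHd m.
have split_var (l : 'X_{1..n.+1}) : l ord0 = 0%N -> mdeg l != 0%N ->
    exists2 i, i != ord0 & l = (U_(i) + (l - U_(i)))%MM.
  move=> l0 /mnm_split1[i li lE]; exists i => //.
  by apply: contraNneq li => ->; rewrite l0.
have [m0|m_neq0] := eqVneq (mdeg m) 0%N.
  move=> _ _ _; exists 1; rewrite /poly_eval rmorph1.
  by move/eqP: m0; rewrite mdeg_eq0 => /eqP->; rewrite mpolyX0.
move=> lt_md m0 ev; have [i i0 mE] := split_var _ m0 m_neq0.
set l := (m - U_(i))%MM in mE.
have dm : mdeg m = (mdeg l).+1 by rewrite mE mdegD mdeg1.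
have l0 : l ord0 = 0%N by rewrite mnmBE m0.
(* An even nonzero degree is at least 2, so a second variable is available. *)
have l_neq0 : mdeg l != 0%N by apply: contraNneq ev => l_eq0; rewrite dm l_eq0.
have [j j0 lE] := split_var _ l0 l_neq0.
set k := (l - U_(j))%MM in lE.
have dl : mdeg l = (mdeg k).+1 by rewrite lE mdegD mdeg1.
have [||| P kP] := IHd k.
- by move: lt_md; rewrite dm dl; exact: ltnW.
- by rewrite mnmBE l0.
- by move: ev; rewrite dm dl /= negbK.
have [u uE] := quad_monoP _ _ i0 j0.
exists ('X_(enum_rank u) * P).
rewrite /poly_eval rmorphM /= mmapX mmap1U /= enum_rankK uE.
by rewrite mE lE !mpolyXD mulrA kP.
Qed.

Lemma cocycle_eval p : p \in cocycle A ->
  exists P q, p = poly_eval (@quad_mono K n.+1) P + A q.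
Proof.
move=> Zp; rewrite (cocycle_even p Zp); elim/big_ind: _ => [|p1 p2|m ev].
- by exists 0, 0; rewrite /poly_eval rmorph0 linear0 addr0.
- move=> [P1 [q1 ->]] [P2 [q2 ->]]; exists (P1 + P2), (q1 + q2).
  by rewrite /poly_eval rmorphD linearD addrACA.
have [m0|m_neq0] := eqVneq (m ord0) 0%N.
  have [P ->] := even_mpolyX_eval _ m0 ev.
  exists (p@_m *: P), 0.
  by rewrite linear0 addr0 /poly_eval mmapZ /= -scalerAl mul1r.
have mE : m = (U_(ord0) + (m - U_(ord0)))%MM by rewrite addmC submK // lep1mP.
(* Dividing by [x_1] leaves a monomial of odd degree, which the differential multiplies by [x_1]
   again. *)
exists 0, (p@_m *: 'X_[m - U_(ord0)]).
rewrite /poly_eval rmorph0 add0r linearZ /= diff_mpolyX.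
by move: ev; rewrite {1}mE mdegD mdeg1 /= negbK => ->; rewrite -mpolyXD -mE.
Qed.

Definition kill_x1 : {mpoly K[n.+1]} -> {mpoly K[n.+1]} :=
  mmap (@mpolyC n.+1 K) (fun i => if i == ord0 then 0 else 'X_i).

Lemma kill_x1_diff p : kill_x1 (A p) = 0.
Proof. by rewrite diffE /kill_x1 rmorphM /= mmapX mmap1U eqxx mul0r. Qed.

(** Both indices of a [quad_index] are positive, so no generator involves [x_1]. *)
Lemma kill_x1_eval P :
  kill_x1 (poly_eval (@quad_mono K n.+1) P) = poly_eval (@quad_mono K n.+1) P.
Proof.
rewrite /kill_x1; apply: rmorph_poly_eval => [c|[[i j] ij]].
  by rewrite /= mmapZ rmorph1 mulr1 -mul_mpolyC mulr1.
have /andP[/= i_gt0 le_ij] := ij; have j_gt0 := leq_trans i_gt0 le_ij.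
by rewrite /quad_mono rmorphM /= !mmapX !mmap1U /= -!val_eqE /= !gtn_eqF.
Qed.

(** Evaluating inside the algebra of cocycles gives a common lift [z] of both evaluations, which
    turns questions about classes into questions about polynomials. *)
Lemma poly_eval_quad_class P : exists2 z : cocycles A,
  val z = poly_eval (@quad_mono K n.+1) P
  & poly_eval (quad_class A) P = \pi_(cohomology A) z.
Proof.
pose b u : cocycles A := Cocycle (quad_mono_cocycle u).
pose v : {rmorphism cocycles A -> {mpoly K[n.+1]}} := val.
exists (poly_eval b P); first exact: (rmorph_poly_eval _ _ _ _ v).
symmetry; apply: rmorph_poly_eval => [c|u].
  by rewrite /= pi_cohomologyZ rmorph1.
rewrite /quad_class /cohom_class; congr \pi.
(* The default 0 of [insubd] is avoided because the generators are cocycles. *)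
by apply: val_inj; rewrite insubdK // quad_mono_cocycle.
Qed.

Lemma pi_cohomology_eq0 (z : cocycles A) :
  \pi_(cohomology A) z = 0 <-> exists p, A p = val z.
Proof.
rewrite -(rmorph0 \pi_(cohomology A)).
split=> [/eqP|/coboundaryP dz].
  by rewrite -Quotient.idealrBE subr0 => /coboundaryP.
by apply/eqP; rewrite -Quotient.idealrBE subr0.
Qed.

End FirstVariableDifferential.

(** Surjectivity and equality of kernels together identify the cohomology with the subalgebra of
    [K[x_2, ..., x_n]] generated by the [x_i x_j]. *)
Theorem proposition5p1 (K : closedFieldType) (n : nat) (A : dg_mpoly K n) :
  [pchar K] =i pred0 ->
  (1 <= n)%N ->
  is_dg_A (fun j : 'I_n => ((j : nat) == 0%N)%:R) A ->
  [/\ forall u : quad_index n, quad_mono K u \in cocycle A,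
      forall h : cohomology A, exists P, h = poly_eval (quad_class A) P
    & forall P, poly_eval (quad_class A) P = 0 <-> poly_eval (quad_mono K) P = 0].
Proof.
case: n A => // n A _ _ AX; split=> [u|h|P].
- exact: quad_mono_cocycle.
- elim/quotW: h => z; have [P [q zE]] := cocycle_eval _ _ _ AX _ (valP z).
  exists P; have [y yE ->] := poly_eval_quad_class _ _ _ AX P.
  apply/eqP; rewrite -subr_eq0 -rmorphB; apply/eqP/pi_cohomology_eq0.
  by exists q; rewrite rmorphB /= yE zE addrC addKr.
have [z zE ->] := poly_eval_quad_class _ _ _ AX P; rewrite -zE.
split=> [/pi_cohomology_eq0[p dp]|z0].
  (* Setting [x_1 = 0] fixes [z] and kills [A p], yet the two are equal. *)
  by rewrite zE -kill_x1_eval -zE -dp kill_x1_diff.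
by apply/pi_cohomology_eq0; exists 0; rewrite z0 linear0.
Qed.
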